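(* Consider the continuous-time system $\dot z=f(z,u)$, with $f:\mathbb{R}^{n_z}\times\mathbb{R}^{n_u}\to\mathbb{R}^{n_z}$ polynomial, in feedback with a neural network controller $u=\pi(z)$, where $\pi:\mathbb{R}^{n_z}\to\mathbb{R}^{n_u}$ is the feed-forward fully-connected network defined in the context. Let the equilibrium of the closed-loop system $\dot z=f(z,\pi(z))$ be $z^*=0$. Suppose the input-output properties of the network are described by the semi-algebraic set $S=\{x : g_i(x)\ge 0,\ h_j(x)=0,\ i=1,\dots,p,\ j=1,\dots,q\}$ with $g_i,h_j$ polynomials in the network states $x$ (as explained in the context). Let $X=(x,z)$ be the vector of all the system and network states. Suppose there exists a polynomial function $V(z)$ satisfying, together with a positive definite polynomial $\rho(z)$ and polynomials $s_i$, $t_j$, the following conditions: $$V(z)-\rho(z)\in\Sigma[z],$$ $$-\frac{\partial V}{\partial z}f(z,\pi(z))-\sum_{j=1}^{q}t_j(X)h_j(x)-\sum_{i=1}^{p}s_i(X)g_i(x)\in\Sigma[X],$$ $$s_i(X)\in\Sigma[X]\ \ \forall i=1,\dots,p,\qquad t_j(X)\in\mathbb{R}[X]\ \ \forall j=1,\dots,q,$$ where in the second condition $\pi(z)$ stands for the expression $W^\ell x^\ell+b^\ell$ in the network states, so that the left-hand side is a polynomial in $X$. Then the equilibrium of the closed-loop system (the neural feedback loop) is stable.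
   Context: Neural network controller: with weight matrices $W^k\in\mathbb{R}^{n_{k+1}\times n_k}$ and biases $b^k\in\mathbb{R}^{n_{k+1}}$, $k=0,\dots,\ell$ (where $n_0=n_z$, $n_{\ell+1}=n_u$), and an activation function $\phi$ (for instance ReLU, $\phi(v)=\max(0,v)$, or $\tanh$) applied element-wise, set $x^0=z$, $v^k=W^kx^k+b^k$ and $x^{k+1}=\phi(v^k)$ for $k=0,\dots,\ell-1$, and $\pi(z)=W^\ell x^\ell+b^\ell$. The network states $x$ are the layer variables $x^1,\dots,x^\ell$; the network input is $x^0=z$, and the constraint polynomials may also involve it. That the input-output properties of the network are described by $S$ means that the values of the network states produced by the network, for any input $z$, satisfy all the constraints $g_i\ge 0$ and $h_j=0$. $\mathbb{R}[X]$ is the set of polynomials in $X$ with real coefficients, and $\Sigma[X]$ is the set of sum of squares polynomials, i.e. those of the form $\sum_i r_i(X)^2$ with $r_i$ polynomials; $\Sigma[z]$ is defined likewise. $\rho$ positive definite means $\rho(0)=0$ and $\rho(z)>0$ for $z\ne 0$. $\frac{\partial V}{\partial z}$ is the row vector of partial derivatives of $V$. Stable means stable in the sense of Lyapunov.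
   Formalization: The formal theorem additionally assumes V(0) = 0; without it the claim fails, e.g. n_z = 1, zero controller, p = q = 0, f = 2z − 4z³, V = 1 − z² + z⁴, ρ = z²/2 meets all conditions but 0 is unstable. *)

(* Defs.v *)
From HB Require Import structures.
From mathcomp Require Import all_boot all_order all_algebra.
From mathcomp Require Import all_classical all_reals all_analysis.
(* mpoly's notations are incompatible with those of MathComp-Analysis. *)
From mathcomp Require Import -(notations) mpoly.

Set Implicit Arguments.
Unset Strict Implicit.
Unset Printing Implicit Defensive.

Import Order.TTheory GRing.Theory Num.Theory.
Import numFieldNormedType.Exports.

Local Open Scope classical_set_scope.
Local Open Scope ring_scope.

Notation "{ 'mpoly' T [ n ] }" := (mpoly n T)
  (at level 0, T, n at level 2, format "{ 'mpoly'  T [ n ] }") : type_scope.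

Section Polynomials.
Variable R : realType.

Definition peval n (x : 'cV[R]_n) (p : {mpoly R[n]}) : R :=
  meval (fun i => x i 0) p.

(* Substitution of the i-th entry of [q] for the i-th variable of [p]. *)
Definition psubst n m (q : 'cV[{mpoly R[m]}]_n) (p : {mpoly R[n]}) :
    {mpoly R[m]} :=
  comp_mpoly [tuple q i 0 | i < n] p.

Definition is_sos n (p : {mpoly R[n]}) : Prop :=
  exists r : seq {mpoly R[n]}, p = \sum_(ri <- r) ri ^+ 2.

Definition posdef n (p : {mpoly R[n]}) : Prop :=
  peval 0 p = 0 /\ forall z : 'cV[R]_n, z != 0 -> 0 < peval z p.

Definition pgrad n (p : {mpoly R[n]}) : 'rV[{mpoly R[n]}]_n :=
  \row_i mderiv i p.

Definition semialg n p q (g : 'I_p -> {mpoly R[n]}) (h : 'I_q -> {mpoly R[n]}) :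
    set 'cV[R]_n :=
  [set x | (forall i, 0 <= peval x (g i)) /\ (forall j, peval x (h j) = 0)].

End Polynomials.

Section Stability.
Variables (R : realType) (n : nat).

(* A solution of z' = F z on [0, T[, where T may be +oo; differentiability is
   only asked for in the interior, so that no one-sided derivative is needed
   at time 0. *)
Definition is_solution (F : 'cV[R]_n -> 'cV[R]_n) (T : \bar R)
    (z : R -> 'cV[R]_n) : Prop :=
  {within [set t : R | 0 <= t /\ (t%:E < T)%E], continuous z} /\
  forall t : R, 0 < t -> (t%:E < T)%E -> is_derive t 1 z (F (z t)).

(* The norm is the sup norm of the matrix library, equivalent to the Euclidean
   one.  All solutions are considered, on every interval [0, T[, whether or not
   F is regular enough for existence or uniqueness. *)
Definition lyapunov_stable (F : 'cV[R]_n -> 'cV[R]_n) (ze : 'cV[R]_n) : Prop :=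
  forall eps : R, 0 < eps -> exists2 delta : R, 0 < delta &
    forall (T : \bar R) (z : R -> 'cV[R]_n), is_solution F T z ->
      `|z 0 - ze| < delta ->
      forall t : R, 0 <= t -> (t%:E < T)%E -> `|z t - ze| < eps.

End Stability.

(* Layer k has width [d k]; the input layer is 0, the last hidden layer is [l]
   and the output has width [d l.+1].  Weights and biases of index greater than
   [l] play no role. *)
Section Network.
Variables (R : realType) (l : nat) (d : nat -> nat).
Variables (W : forall k, 'M[R]_(d k.+1, d k)) (b : forall k, 'cV[R]_(d k.+1)).
Variable phi : R -> R.

Fixpoint layer (z : 'cV[R]_(d 0%N)) (k : nat) : 'cV[R]_(d k) :=
  if k is k'.+1 then map_mx phi (W k' *m layer z k' + b k') else z.

Definition controller (z : 'cV[R]_(d 0%N)) : 'cV[R]_(d l.+1) :=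
  W l *m layer z l + b l.

(* The vector X = (x, z) of all states stacks the layers 0, ..., l: block 0 is
   the system state z = x^0, the others are the network states x^1, ..., x^l. *)
Definition nstates : nat := \sum_(k < l.+1) d k.

Definition states (z : 'cV[R]_(d 0%N)) : 'cV[R]_nstates :=
  \mxcol_(k < l.+1) layer z k.

(* The variables of R[X] forming block k. *)
Definition Xblock (k : 'I_l.+1) : 'cV[{mpoly R[nstates]}]_(d k) :=
  \col_i mpolyX R (mnm1 (tagnat.Rank k i)).

Definition Xz : 'cV[{mpoly R[nstates]}]_(d 0%N) := Xblock ord0.

(* The output W^l x^l + b^l, with x^l a vector of variables. *)
Definition Xcontroller : 'cV[{mpoly R[nstates]}]_(d l.+1) :=
  map_mx (@mpolyC _ R) (W l) *m Xblock ord_max + map_mx (@mpolyC _ R) (b l).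

Definition closed_loop (f : 'cV[{mpoly R[d 0%N + d l.+1]}]_(d 0%N))
    (z : 'cV[R]_(d 0%N)) : 'cV[R]_(d 0%N) :=
  map_mx (peval (col_mx z (controller z))) f.

(* (dV/dz) f(z, pi(z)) as a polynomial in X. *)
Definition Xlie (V : {mpoly R[d 0%N]})
    (f : 'cV[{mpoly R[d 0%N + d l.+1]}]_(d 0%N)) : {mpoly R[nstates]} :=
  (map_mx (psubst Xz) (pgrad V) *m
   map_mx (psubst (col_mx Xz Xcontroller)) f) 0 0.

End Network.

(* Main.v *)
(* Evaluated at the states produced by the network on z, the second sum of
   squares condition says that the derivative of V along the closed loop is at
   most 0, since there h_j = 0 and s_i g_i >= 0; hence V decreases along
   solutions.  As rho <= V, V is bounded below by a positive constant on each
   sphere around 0; by the intermediate value theorem a solution leaving the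
   ball would cross the sphere, which is impossible if V is small enough at the
   initial state. *)
Require Import Defs.
From HB Require Import structures.
From mathcomp Require Import all_boot all_order all_algebra.
From mathcomp Require Import all_classical all_reals all_analysis.
From mathcomp Require Import -(notations) mpoly.

Set Implicit Arguments.
Unset Strict Implicit.
Unset Printing Implicit Defensive.

Import Order.TTheory GRing.Theory Num.Theory.
Import numFieldNormedType.Exports.

Local Open Scope classical_set_scope.
Local Open Scope ring_scope.

(** Constants and variables generate the polynomials as a ring, so continuity and the chain rule
    below reduce to these two cases. *)
Lemma mpoly_ring_ind (R : nzRingType) (n : nat) (P : {mpoly R[n]} -> Prop) :
  (forall c, P (mpolyC n c)) -> (forall i, P (mpolyX R (mnm1 i))) ->
  (forall p q, P p -> P q -> P (p + q)) ->
  (forall p q, P p -> P q -> P (p * q)) ->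
  forall p, P p.
Proof.
move=> PC PX PD PM; elim/mpolyind => [|c m p _ _ Pp].
  by rewrite -mpolyC0; exact: PC.
apply: PD Pp; rewrite -mul_mpolyC; apply: (PM _ _ (PC c)).
rewrite mpolyXE_id.
elim/big_ind : _ => [||i _]; [by rewrite -mpolyC1; exact: PC|exact: PM|].
elim: (m i) => [|k IHk]; first by rewrite expr0 -mpolyC1; exact: PC.
by rewrite exprS; exact: PM.
Qed.

Section PolynomialEvaluation.
Variable R : realType.

HB.instance Definition _ n (x : 'cV[R]_n) :=
  GRing.RMorphism.copy (@peval R n x) (meval (fun i => x i 0)).

Lemma pevalC n (x : 'cV[R]_n) c : peval x (mpolyC n c) = c.
Proof. exact: mevalC. Qed.

Lemma pevalX n (x : 'cV[R]_n) i : peval x (mpolyX R (mnm1 i)) = x i 0.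
Proof. exact: mevalXU. Qed.

Lemma peval_psubst n m (x : 'cV[R]_m) (q : 'cV[{mpoly R[m]}]_n) p :
  peval x (psubst q p) = peval (map_mx (peval x) q) p.
Proof.
rewrite /peval /psubst comp_mpoly_meval; congr meval.
by apply/funext => i; rewrite tnth_mktuple mxE.
Qed.

Lemma is_sos_peval_ge0 n (x : 'cV[R]_n) p : is_sos p -> 0 <= peval x p.
Proof.
move=> [r ->]; rewrite rmorph_sum; apply: sumr_ge0 => i _.
by rewrite expr2 rmorphM -expr2 sqr_ge0.
Qed.

(** Convergence is assumed coordinatewise and along any filter, which also covers row vectors read
    through [trmx]. *)
Lemma cvg_peval n (T : Type) (F : set_system T) {FF : Filter F}
    (z : T -> 'cV[R]_n) (x : 'cV[R]_n) (p : {mpoly R[n]}) :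
  (forall i, z t i 0 @[t --> F] --> x i 0) ->
  peval (z t) p @[t --> F] --> peval x p.
Proof.
move=> zx; elim/mpoly_ring_ind : p => [c|i|p q cp cq|p q cp cq].
- under eq_fun do rewrite pevalC; rewrite pevalC; exact: cvg_cst.
- by under eq_fun do rewrite pevalX; rewrite pevalX; exact: zx.
- by under eq_fun do rewrite rmorphD; rewrite rmorphD /=; exact: cvgD.
- by under eq_fun do rewrite rmorphM; rewrite rmorphM; exact: cvgM.
Qed.

Lemma peval_continuous n (p : {mpoly R[n]}) :
  continuous (fun x : 'cV[R]_n => peval x p).
Proof.
move=> x; apply: (@cvg_peval _ _ (nbhs x) _ id) => i; exact: coord_continuous.
Qed.

Lemma is_derive_coord m n (z : R -> 'M[R]_(m, n)) (t : R) dz i j :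
  is_derive t 1 z dz -> is_derive t 1 (fun s => z s i j) (dz i j).
Proof.
move=> [zt <-]; have /derivable_mxP /(_ i j) zijt := zt.
by apply: DeriveDef => //; rewrite (derive_mx zt) mxE.
Qed.

Lemma is_derive_peval n (z : R -> 'cV[R]_n) (t : R) dz (p : {mpoly R[n]}) :
  is_derive t 1 z dz ->
  is_derive t 1 (fun s => peval (z s) p)
    ((map_mx (peval (z t)) (pgrad p) *m dz) 0 0).
Proof.
move=> zt.
(* Written as a sum over partial derivatives, the chain rule is compatible with sums and, by
   Leibniz, products of polynomials. *)
suff : is_derive t 1 (fun s => peval (z s) p)
    (\sum_i peval (z t) (mderiv i p) * dz i 0).
  move=> /is_derive_eq; apply; rewrite mxE.
  by apply: eq_bigr => i _; rewrite !mxE.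
elim/mpoly_ring_ind : p => [c|i|p q dp dq|p q dp dq].
- under eq_fun do rewrite pevalC; apply: is_derive_eq.
  by rewrite big1 // => i _; rewrite mderivC rmorph0 mul0r.
- under eq_fun do rewrite pevalX.
  apply: is_derive_eq (is_derive_coord _ _ zt) _.
  rewrite (bigD1 i) //= big1 => [|j ji]; rewrite mderivX mnmE.
    rewrite eqxx scale1r -[X in mnm_sub X _]add0m addmK addr0.
    by rewrite mpolyX0 -mpolyC1 pevalC mul1r.
  by rewrite eq_sym (negbTE ji) scale0r rmorph0 mul0r.
- under eq_fun do rewrite rmorphD.
  apply: is_derive_eq (is_deriveD dp dq) _.
  rewrite -big_split; apply: eq_bigr => i _ /=.
  by rewrite mderivD rmorphD mulrDl.
- under eq_fun do rewrite rmorphM.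
  apply: is_derive_eq (is_deriveM dp dq) _.
  rewrite !scaler_sumr -big_split; apply: eq_bigr => i _ /=.
  rewrite mderivM rmorphD !rmorphM /GRing.scale /= mulrDl addrC.
  by congr (_ + _); rewrite ?mulrA // [peval _ q * _]mulrC.
Qed.

(** Moves spheres from columns to rows, the setting of [EVT_min_rV]. *)
Lemma norm_trmx m n (A : 'M[R]_(m, n)) : `|A^T| = `|A|.
Proof.
rewrite [LHS]mx_normrE [RHS]mx_normrE.
rewrite (reindex (fun ij : 'I_m * 'I_n => (ij.2, ij.1))) /=; last first.
  by exists (fun ij => (ij.2, ij.1)) => -[].
by apply: eq_bigr => ij _; rewrite mxE.
Qed.

(* A lower bound rather than an attained minimum: in dimension 0 the sphere is
   empty. *)
Lemma posdef_sphere_lbound n (rho : {mpoly R[n]}) (e : R) :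
  posdef rho -> 0 < e ->
  exists2 m, 0 < m & forall x : 'cV[R]_n, `|x| = e -> m <= peval x rho.
Proof.
move=> [_ rho_gt0] e_gt0.
pose A := [set v : 'rV[R]_n | `|v| = e].
have [A0|/set0P A0] := eqVneq A set0.
  exists 1 => // x xe.
  by have : A x^T by [rewrite /A /= norm_trmx]; rewrite A0.
(* The sphere is compact, and a minimiser [c] is nonzero because its norm is [e > 0]; hence the
   minimum of [rho] is positive. *)
have [||c cA minc] := EVT_min_rV (f := fun v => peval v^T rho) A0.
- apply: bounded_closed_compact.
    exists e; split; first exact: gtr0_real.
    by move=> M eM v /= ->; exact: ltW.
  by apply: (closed_comp _ (@closed_eq _ e)) => v _; exact: norm_continuous.
- apply: continuous_subspaceT => v.
  apply: (@cvg_peval _ _ (nbhs v) _ trmx) => i.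
  under eq_fun do rewrite mxE; rewrite mxE; exact: coord_continuous.
- exists (peval c^T rho).
    apply: rho_gt0; rewrite -normr_gt0 norm_trmx.
    by move: cA; rewrite inE /A /= => ->.
  move=> x xe; have := minc x^T; rewrite trmxK; apply.
  by rewrite inE /A /= norm_trmx.
Qed.

End PolynomialEvaluation.

Section Network.
Variables (R : realType) (l : nat) (d : nat -> nat).
Variables (W : forall k, 'M[R]_(d k.+1, d k)) (b : forall k, 'cV[R]_(d k.+1)).
Variable phi : R -> R.

Lemma peval_Xblock z (k : 'I_l.+1) :
  map_mx (peval (states l W b phi z)) (Xblock R d k) = layer W b phi z k.
Proof.
(* [Xblock] and the stacked [states] share the same indexing of block entries. *)
rewrite -[RHS](mxcolK (fun k : 'I_l.+1 => layer W b phi z k) k).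
by apply/matrixP => i j; rewrite !mxE pevalX (ord1 j) mxE.
Qed.

Lemma peval_Xz z : map_mx (peval (states l W b phi z)) (Xz R l d) = z.
Proof. exact: (peval_Xblock z ord0). Qed.

Lemma map_mx_peval_mxC n (x : 'cV[R]_n) i j (A : 'M[R]_(i, j)) :
  map_mx (peval x) (map_mx (@mpolyC n R) A) = A.
Proof. by apply/matrixP => ? ?; rewrite !mxE pevalC. Qed.

Lemma peval_Xcontroller z :
  map_mx (peval (states l W b phi z)) (Xcontroller l W b) =
  controller l W b phi z.
Proof.
rewrite map_mxD map_mxM /= !map_mx_peval_mxC.
exact: (congr1 (fun v => W l *m v + b l) (peval_Xblock z ord_max)).
Qed.

(** At the states produced by the network, the variables of the last hidden layer take their true
    values, so the formal output becomes the controller and the formal Lie derivative the actual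
    one. *)
Lemma peval_Xlie z V f :
  peval (states l W b phi z) (Xlie W b V f) =
  (map_mx (peval z) (pgrad V) *m closed_loop W b phi f z) 0 0.
Proof.
rewrite /Xlie !mxE rmorph_sum; apply: eq_bigr => i _.
rewrite rmorphM /= !mxE !peval_psubst map_col_mx peval_Xcontroller.
by rewrite peval_Xz.
Qed.

End Network.

Section Lyapunov.
Variables (R : realType) (n : nat).
Implicit Types (F : 'cV[R]_n -> 'cV[R]_n) (V rho : {mpoly R[n]}).

Lemma is_solution_within F T (z : R -> 'cV[R]_n) t :
  is_solution F T z -> (t%:E < T)%E -> {within `[0, t], continuous z}.
Proof.
move=> [cz _] tT; apply: continuous_subspaceW cz => s /=.
rewrite in_itv /= => /andP[-> st]; split=> //.
by apply: le_lt_trans tT; rewrite lee_fin.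
Qed.

Lemma peval_solution_nincr F V T (z : R -> 'cV[R]_n) t :
  (forall x, (map_mx (peval x) (pgrad V) *m F x) 0 0 <= 0) ->
  is_solution F T z -> 0 <= t -> (t%:E < T)%E ->
  peval (z t) V <= peval (z 0) V.
Proof.
move=> dV_le0 zsol t0 tT.
have dV s : s \in `]0, t[ -> is_derive s 1 (fun s => peval (z s) V)
    ((map_mx (peval (z s)) (pgrad V) *m F (z s)) 0 0).
  rewrite in_itv /= => /andP[s0 st]; apply: is_derive_peval.
  by apply: zsol.2 => //; apply: lt_trans tT; rewrite lte_fin.
apply: (@ler0_derive1_le_cc _ (fun s => peval (z s) V) 0 t) => //.
- by move=> s /dV[].
- by move=> s /dV ds; rewrite derive1E derive_val.
- apply: (@within_continuous_comp _ _ _ _ z (fun x => peval x V)) => [x _|].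
    exact: peval_continuous.
  exact: is_solution_within zsol tT.
- by rewrite in_itv /= lexx t0.
- by rewrite in_itv /= lexx t0.
Qed.

(** Lyapunov's direct method for an arbitrary vector field, independent of the network. *)
Lemma lyapunov_stable_poly F V rho :
  peval 0 V = 0 -> posdef rho ->
  (forall x, peval x rho <= peval x V) ->
  (forall x, (map_mx (peval x) (pgrad V) *m F x) 0 0 <= 0) ->
  lyapunov_stable F 0.
Proof.
move=> V0 rho_pd rhoV dV_le0 eps eps_gt0.
have [m m_gt0 m_le] := posdef_sphere_lbound rho_pd eps_gt0.
have : \forall x \near (0 : 'cV[R]_n), peval x V < m.
  have := @peval_continuous _ _ V 0; rewrite /continuous_at V0.
  by move=> /cvgr_lt; apply.
move=> /nbhs_norm0P [r /= r_gt0 rV].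
(* [r] puts the initial value of [V] below [m]; [eps] makes the solution start inside the sphere, as
   the intermediate value theorem requires. *)
exists (Num.min r eps) => [|T z zsol]; first by rewrite lt_min r_gt0.
rewrite subr0 lt_min => /andP[/rV V0m z0eps] t t_ge0 tT.
rewrite subr0 ltNge; apply/negP => eps_le.
have [||s] := @IVT _ (fun s => `|z s|) 0 t eps t_ge0.
- apply: (@within_continuous_comp _ _ _ _ z Num.norm) => [x _|].
    exact: norm_continuous.
  exact: is_solution_within zsol tT.
- by rewrite ge_min le_max (ltW z0eps) eps_le orbT.
rewrite in_itv /= => /andP[s_ge0 st] zs.
have sT : (s%:E < T)%E by apply: le_lt_trans tT; rewrite lee_fin.
(* At the crossing time, [V (z s) <= V (z 0) < m <= rho (z s) <= V (z s)]. *)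
have := peval_solution_nincr dV_le0 zsol s_ge0 sT.
by rewrite leNgt (lt_le_trans V0m) // (le_trans (m_le _ zs)).
Qed.

End Lyapunov.

(** [V(0) = 0] is an explicit assumption: it does not follow from the other conditions, and
    stability can fail without it. In dimension one, [V = (z-1)^2 + 1], [rho = z^2/4] and
    [f = z^2 (1-z)] satisfy them with no constraints, yet 0 is unstable. *)
Theorem proposition1 (R : realType)
  (l : nat) (d : nat -> nat)
  (W : forall k : nat, 'M[R]_(d k.+1, d k))
  (b : forall k : nat, 'cV[R]_(d k.+1))
  (phi : R -> R)
  (f : 'cV[{mpoly R[d 0%N + d l.+1]}]_(d 0%N))
  (f_eq0 : closed_loop W b phi f 0 = 0)
  (p q : nat)
  (g : 'I_p -> {mpoly R[nstates l d]})
  (h : 'I_q -> {mpoly R[nstates l d]})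
  (network_in_S : forall z : 'cV[R]_(d 0%N), semialg g h (states l W b phi z))
  (ex_V : exists (V rho : {mpoly R[d 0%N]})
      (s : 'I_p -> {mpoly R[nstates l d]})
      (t : 'I_q -> {mpoly R[nstates l d]}),
    [/\ peval 0 V = 0,
        posdef rho,
        is_sos (V - rho),
        is_sos (- Xlie W b V f
                - \sum_(j < q) t j * h j
                - \sum_(i < p) s i * g i)
      & forall i : 'I_p, is_sos (s i)]) :
  lyapunov_stable (closed_loop W b phi f) 0.
Proof.
case: ex_V => V [rho [s [t [V0 rho_pd Vrho_sos lie_sos s_sos]]]].
apply: (lyapunov_stable_poly V0 rho_pd) => z.
  by rewrite -subr_ge0 -rmorphB; exact: is_sos_peval_ge0.
have [g_ge0 h_eq0] := network_in_S z.
have := is_sos_peval_ge0 (states l W b phi z) lie_sos.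
rewrite !rmorphB rmorphN /= peval_Xlie !rmorph_sum.
rewrite [X in _ - X - _]big1 => [|j _]; last by rewrite rmorphM /= h_eq0 mulr0.
(* The derivative of [V] is at most minus the sum of the [s_i g_i]. *)
rewrite subr0 subr_ge0 lerNr => /le_trans; apply; rewrite oppr_le0.
apply: sumr_ge0 => i _; rewrite rmorphM mulr_ge0 //=.
exact/is_sos_peval_ge0/s_sos.
Qed.
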